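(* Let $N$ be a positive integer and $a\in\{1,2,\ldots,N\}$. For an index $\mathbf{k}=(k_1,\ldots,k_n)$ with $k_1,\ldots,k_n>1$, we have $$\sum_{\sigma\in S_n}t_{N,a}(k_{\sigma(1)},\ldots,k_{\sigma(n)})=\sum_{\Pi\in\mathcal{P}_n}\widetilde{c}(\Pi)\,t_{N,a}(\mathbf{k},\Pi),$$ $$\sum_{\sigma\in S_n}t^\star_{N,a}(k_{\sigma(1)},\ldots,k_{\sigma(n)})=\sum_{\Pi\in\mathcal{P}_n}c(\Pi)\,t^\star_{N,a}(\mathbf{k},\Pi),$$ where $S_n$ is the symmetric group of degree $n$.
   Context: For positive integers $k_1,\ldots,k_n$ with $k_1>1$, $$t_{N,a}(k_1,\ldots,k_n)=\sum_{m_1>\cdots>m_n>0,\ m_i\equiv a\ (\mathrm{mod}\ N)}\frac{1}{m_1^{k_1}\cdots m_n^{k_n}},\qquad t^\star_{N,a}(k_1,\ldots,k_n)=\sum_{m_1\geq\cdots\geq m_n>0,\ m_i\equiv a\ (\mathrm{mod}\ N)}\frac{1}{m_1^{k_1}\cdots m_n^{k_n}}.$$ $\mathcal{P}_n$ is the set of all partitions of the set $\{1,2,\ldots,n\}$. For $\Pi=\{P_1,\ldots,P_l\}\in\mathcal{P}_n$, $c(\Pi)=\prod_{j=1}^l(|P_j|-1)!$ and $\widetilde{c}(\Pi)=(-1)^{n-l}c(\Pi)$, and $$t_{N,a}(\mathbf{k},\Pi)=\prod_{j=1}^l t_{N,a}\Bigl(\sum_{i\in P_j}k_i\Bigr),\qquad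 t^\star_{N,a}(\mathbf{k},\Pi)=\prod_{j=1}^l t^\star_{N,a}\Bigl(\sum_{i\in P_j}k_i\Bigr).$$ *)

(* Defs.v *)
From HB Require Import structures.
From mathcomp Require Import all_boot all_order all_algebra all_fingroup.
From mathcomp Require Import finmap.
From mathcomp Require Import all_classical all_reals all_analysis.
From mathcomp Require Import ring.
Set Implicit Arguments.
Unset Strict Implicit.
Unset Printing Implicit Defensive.
Import Order.TTheory GRing.Theory Num.Theory.
Local Open Scope classical_set_scope.
Local Open Scope ring_scope.

(* Positions are 0-based: for i : 'I_n, m i and k i stand for m_(i+1) and
   k_(i+1). *)
Definition t_index (N a n : nat) : set {ffun 'I_n -> nat} :=
  [set m | (forall i j : 'I_n, (i < j)%N -> (m j < m i)%N) /\
           (forall i : 'I_n, (0 < m i)%N /\ (m i = a %[mod N])%N)].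

Definition tstar_index (N a n : nat) : set {ffun 'I_n -> nat} :=
  [set m | (forall i j : 'I_n, (i <= j)%N -> (m j <= m i)%N) /\
           (forall i : 'I_n, (0 < m i)%N /\ (m i = a %[mod N])%N)].

Arguments t_index : clear implicits.
Arguments tstar_index : clear implicits.

Definition t_term (R : realType) (n : nat) (k : 'I_n -> nat)
    (m : {ffun 'I_n -> nat}) : R :=
  1 / \prod_(i < n) (m i)%:R ^+ k i.

(* All terms are nonnegative, so the multiple series is the unordered sum
   [esum] in [0, +oo]. [fine] would send a divergent sum to 0, but this does
   not occur when all k i > 1: see [t_fin_num] and [tstar_fin_num]. *)
Definition t_sum (R : realType) (N a n : nat) (k : 'I_n -> nat) : R :=
  fine (\esum_(m in t_index N a n) (t_term R k m)%:E).

Definition tstar_sum (R : realType) (N a n : nat) (k : 'I_n -> nat) : R :=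
  fine (\esum_(m in tstar_index N a n) (t_term R k m)%:E).

Definition set_partitions (n : nat) : {set {set {set 'I_n}}} :=
  [set Pi : {set {set 'I_n}} | finset.partition Pi [set: 'I_n]%SET]%SET.

Definition cpart (n : nat) (Pi : {set {set 'I_n}}) : nat :=
  (\prod_(P in Pi) (#|P|.-1)`!)%N.

Definition cpart_tilde (n : nat) (Pi : {set {set 'I_n}}) : int :=
  (-1) ^+ (n - #|Pi|)%N * (cpart Pi)%:Z.

Definition t_part (R : realType) (N a n : nat) (k : 'I_n -> nat)
    (Pi : {set {set 'I_n}}) : R :=
  \prod_(P in Pi) t_sum R N a (fun _ : 'I_1 => \sum_(i in P) k i)%N.

Definition tstar_part (R : realType) (N a n : nat) (k : 'I_n -> nat)
    (Pi : {set {set 'I_n}}) : R :=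
  \prod_(P in Pi) tstar_sum R N a (fun _ : 'I_1 => \sum_(i in P) k i)%N.

Lemma t_term_ge0 (R : realType) n (k : 'I_n -> nat) m : 0 <= t_term R k m.
Proof. by rewrite divr_ge0 //; apply: prodr_ge0 => i _; rewrite exprn_ge0. Qed.

Lemma t_index_sub (N a n : nat) : t_index N a n `<=` tstar_index N a n.
Proof.
move=> m [hm hp]; split=> // i j; rewrite leq_eqVlt => /orP[/eqP/val_inj -> //|].
by move=> /hm /ltnW.
Qed.

Lemma inv_pow_sum_le2 (R : realType) (e M : nat) : (1 < e)%N ->
  \sum_(j < M) (if (0 < j)%N then (j%:R ^+ e)^-1 else 0) <= 2 :> R.
Proof.
move=> e1.
suff H : forall M', \sum_(j < M'.+2) (if (0 < j)%N then (j%:R ^+ e)^-1 else 0)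
    <= 2 - M'.+1%:R^-1 :> R.
  case: M => [|[|M]]; first by rewrite big_ord0.
    by rewrite big_ord_recr big_ord0 /= addr0.
  by apply: le_trans (H M) _; rewrite gerBl invr_ge0.
elim=> [|M' IH].
  by rewrite !big_ord_recr big_ord0 /= add0r add0r expr1n invr1 lerBrDr.
rewrite big_ord_recr /=; apply: le_trans (lerD IH (lexx _)) _.
have hx : (0 : R) < M'.+1%:R by rewrite ltr0n.
have hy : (0 : R) < M'.+2%:R by rewrite ltr0n.
have hp : (M'.+2%:R ^+ e)^-1 <= (M'.+1%:R * M'.+2%:R)^-1 :> R.
  rewrite lef_pV2 ?posrE ?mulr_gt0 ?exprn_gt0 //.
  apply: (@le_trans _ _ (M'.+2%:R ^+ 2)).
    by rewrite expr2 ler_pM2r // ler_nat.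
  by apply: ler_weXn2l => //; rewrite ler1n.
apply: le_trans (lerD (lexx _) hp) _.
rewrite le_eqVlt; apply/orP; left; apply/eqP.
have hyE : M'.+2%:R = M'.+1%:R + 1 :> R by rewrite -natr1.
rewrite hyE in hy *.
by field; rewrite !lt0r_neq0.
Qed.

Lemma tstar_fin_num (R : realType) (N a n : nat) (k : 'I_n -> nat) :
  (forall i, (1 < k i)%N) ->
  \esum_(m in tstar_index N a n) (t_term R k m)%:E \is a fin_num.
Proof.
move=> hk; rewrite ge0_fin_numE; last first.
  by apply: esum_ge0 => m _; rewrite lee_fin t_term_ge0.
apply: (@le_lt_trans _ _ (2 ^+ n)%:E); last by rewrite ltry.
apply: ge_ereal_sup => _ [F [finF FA] <-].
rewrite fsumEFin // lee_fin fsbig_finite //=.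
set s := fset_set F.
pose M := (\max_(m <- s) \max_(i < n) m i).+1.
have ltM m i : m \in s -> (m i < M)%N.
  move=> ms; rewrite ltnS; apply: (@leq_trans (\max_(i < n) m i)).
    exact: (@leq_bigmax _ (fun i => m i)).
  by apply: (@leq_bigmax_seq _ (enum_fset s) xpredT (fun m : {ffun _ -> _} => \max_(i < n) m i)%N m).
pose g (j : 'I_M) e : R := if (0 < j)%N then (j%:R ^+ e)^-1 else 0.
have g0 j e : 0 <= g j e by rewrite /g; case: ifP => // _; rewrite invr_ge0 exprn_ge0.
pose h (m : {ffun 'I_n -> nat}) : {ffun 'I_n -> 'I_M} := [ffun i => inord (m i)].
pose G (f : {ffun 'I_n -> 'I_M}) : R := \prod_(i < n) g (f i) (k i).
have hG m : m \in s -> t_term R k m = G (h m).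
  move=> ms; have /FA[_ mp] : F m by move: ms; rewrite in_fset_set // inE.
  rewrite /t_term div1r -prodfV; apply: eq_bigr => i _.
  by rewrite /g ffunE inordK ?ltM // (mp i).1.
have hinj : {in s &, injective h}.
  move=> m1 m2 s1 s2 /ffunP e; apply/ffunP => i.
  by have := e i; rewrite !ffunE => /(congr1 val); rewrite /= !inordK ?ltM.
rewrite big_seq (eq_bigr (G \o h)); last by move=> m /hG.
rewrite -big_seq -(big_map h xpredT G).
apply: (@le_trans _ _ (\sum_f G f)).
  have us : uniq (map h s) by rewrite map_inj_in_uniq // fset_uniq.
  rewrite big_uniq //= [leRHS](bigID (mem (map h s))) /= lerDl.
  by apply: sumr_ge0 => f _; apply: prodr_ge0.
rewrite /G -(bigA_distr_bigA (fun i j => g j (k i))).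
apply: (@le_trans _ _ (\prod_(i < n) 2)); last by rewrite prodr_const card_ord.
apply: ler_prod => i _; rewrite sumr_ge0 //=.
exact: inv_pow_sum_le2.
Qed.

Lemma t_fin_num (R : realType) (N a n : nat) (k : 'I_n -> nat) :
  (forall i, (1 < k i)%N) ->
  \esum_(m in t_index N a n) (t_term R k m)%:E \is a fin_num.
Proof.
move=> hk; have := @tstar_fin_num R N a n k hk.
rewrite !ge0_fin_numE; try by apply: esum_ge0 => m _; rewrite lee_fin t_term_ge0.
apply: le_lt_trans; apply: ereal_sup_le => _ [F [finF FA] <-].
by exists F => //; split=> // m /FA /t_index_sub.
Qed.

(* Main.v *)
(** Truncating all variables at a bound [M], both identities become polynomial
identities over the finite set of functions [m : 'I_n -> 'I_M.+1], and are
proved by comparing the coefficients of each [m]. On the left, the coefficient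
is the number of permutations [s] for which [m \o s] is (strictly) decreasing:
the order of the stabiliser of [m] in the weak case (the sorting permutations
form a coset of it), and 1 or 0 according to whether [m] is injective in the
strict case. On the right, it is the sum over the set partitions [Pi] into
blocks where [m] is constant of [\prod_(P in Pi) eps ^ (#|P| - 1) * (#|P| - 1)!],
with [eps] equal to 1 (weak case) or -1 (strict case). Let [F A] denote this sum
for the partitions of a subset [A]. Inserting a new point [x] either as a
singleton or into an existing block gives [F (x |: A) = F A * (1 + eps * l)],
where [l] is the number of points of [A] at which [m] takes the value [m x]; the
left-hand coefficients obey the same recursion. Letting [M] tend to infinity
concludes. *)
Require Import Defs.
From HB Require Import structures.
From mathcomp Require Import all_boot all_order all_algebra all_fingroup.
From mathcomp Require Import ring.
Set Implicit Arguments.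
Unset Strict Implicit.
Unset Printing Implicit Defensive.
Import Order.TTheory GRing.Theory Num.Theory.
Local Open Scope ring_scope.

(** * Sums over set partitions of products of block weights *)

Section PartitionSum.
Variables (T : finType) (K : comNzRingType).
Implicit Types (phi : {set T} -> K) (A B : {set T}).

Definition partition_sum phi A : K :=
  \sum_(Pi : {set {set T}} | partition Pi A) \prod_(P in Pi) phi P.

Lemma partition_sum0 phi : partition_sum phi set0 = 1.
Proof.
rewrite /partition_sum (eq_bigl (pred1 set0)) ?big_pred1_eq ?big_set0 //.
by move=> Pi; rewrite /= partition_set0.
Qed.

(** Deleting the block [B] is a bijection onto the partitions of [A :\: B]; its inverse adds [B]
    back, which cannot already be a block since it is nonempty and disjoint from [A :\: B]. *)
Lemma partition_sum_block phi A B : B \subset A -> B != set0 ->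
  \sum_(Pi : {set {set T}} | partition Pi A && (B \in Pi))
      \prod_(P in Pi) phi P = phi B * partition_sum phi (A :\: B).
Proof.
move=> BA B0; rewrite /partition_sum big_distrr /=.
rewrite (reindex_onto (fun Pi => B |: Pi) (fun Pi => Pi :\ B)) /=; last first.
  by move=> Pi /andP[_ BPi]; rewrite setD1K.
have notin Pi : partition Pi (A :\: B) -> B \notin Pi.
  move=> PiP; apply/negP => BPi; have /subsetP sB := partitionS PiP BPi.
  by have /set0Pn[x xB] := B0; have := sB x xB; rewrite inE xB.
have E Pi : (partition (B |: Pi) A && (B \in B |: Pi)) && ((B |: Pi) :\ B == Pi)
    = partition Pi (A :\: B).
  rewrite setU11 andbT; apply/andP/idP => [[PiP /eqP <-]|PiP].
    by apply: partitionD1 => //; rewrite setU11.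
  rewrite setU1K ?notin // eqxx; split=> //.
  have -> : A = B :|: (A :\: B) by rewrite -{1}(setID A B) (setIidPr BA).
  by apply: partitionU1 => //; rewrite -setI_eq0 setIDA setIC setDIl setDv setI0.
by apply: eq_big => // Pi; rewrite E => /notin h; rewrite big_setU1.
Qed.

(** Double counting of the pairs of a partition and a marked block: the left side chooses the block
    first, the right side the partition. *)
Lemma partition_sum_pointed phi (psi : {set T} -> K) A :
  \sum_(B : {set T} | (B \subset A) && (B != set0))
     psi B * phi B * partition_sum phi (A :\: B) =
  \sum_(Pi : {set {set T}} | partition Pi A)
     (\sum_(B in Pi) psi B) * \prod_(P in Pi) phi P.
Proof.
under eq_bigr => B /andP[BA B0].
  rewrite -mulrA -partition_sum_block // big_distrr /=.
  over.
rewrite (exchange_big_dep (fun Pi => partition Pi A)) /=; last first.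
  by move=> B Pi _ /andP[].
apply: eq_bigr => Pi PiP; rewrite big_distrl /=; apply: eq_bigl => B.
rewrite PiP /=; apply/andP/idP => [[]//|BPi]; split=> //.
by rewrite (partitionS PiP BPi) (partition_neq0 PiP BPi).
Qed.

(** Partitions are classified by the block containing [x]; [B] is that block without [x], possibly
    empty. *)
Lemma partition_sum_setU1 phi x A : x \notin A ->
  partition_sum phi (x |: A) =
  \sum_(B : {set T} | B \subset A) phi (x |: B) * partition_sum phi (A :\: B).
Proof.
move=> xA.
transitivity (\sum_(C : {set T} | (C \subset x |: A) && (x \in C))
    phi C * partition_sum phi ((x |: A) :\: C)).
  have C0 (C : {set T}) : x \in C -> C != set0.
    by move=> xC; apply/set0Pn; exists x.
  under [RHS]eq_bigr => C /andP[CA xC] do rewrite -partition_sum_block ?C0 //.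
  rewrite (exchange_big_dep (fun Pi => partition Pi (x |: A))) /=; last first.
    by move=> B Pi _ /andP[].
  apply: eq_bigr => Pi PiP; rewrite [RHS](big_pred1 (pblock Pi x)) // => C /=.
  have covPi := cover_partition PiP.
  rewrite PiP /=; apply/andP/eqP => [[/andP[_ xC] CPi]|->].
    by rewrite (def_pblock (partition_trivIset PiP) CPi xC).
  have Pix : pblock Pi x \in Pi by rewrite pblock_mem // covPi setU11.
  by rewrite Pix (partitionS PiP) // mem_pblock covPi setU11.
rewrite (reindex_onto (fun B => x |: B) (fun C => C :\ x)) /=; last first.
  by move=> C /andP[_ xC]; rewrite setD1K.
apply: eq_big => [B|B /andP[_ /eqP Bx]].
  rewrite setU11 andbT; apply/andP/idP => [[sB /eqP Bx]|BA].
    apply/subsetP => y yB; have : y \in x |: A.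
      by apply: (subsetP sB); rewrite !inE yB orbT.
    by rewrite !inE => /orP[/eqP yx|//]; move: yB; rewrite -Bx yx setD11.
  rewrite setUS // setU1K //; apply: contra xA; exact: (subsetP BA).
congr (_ * partition_sum _ _); apply/setP => y; rewrite !inE.
by case: (eqVneq y x) => [->|//] /=; rewrite (negbTE xA) andbF.
Qed.

End PartitionSum.

(** * The coefficient of a fixed [m]: partitions into constant blocks, the stabiliser of [m], and
    injectivity *)

Section LevelSets.
Variables (T : finType) (V : eqType) (K : comNzRingType) (m : T -> V).
Implicit Types (A B P : {set T}) (eps : K).

Definition constant_on P := [forall i in P, forall j in P, m i == m j].

Lemma constant_onP P :
  reflect {in P &, forall i j, m i = m j} (constant_on P).
Proof.
apply: (iffP forall_inP) => h i => [j iP jP|iP].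
  by have /forall_inP/(_ j jP)/eqP := h i iP.
by apply/forall_inP => j jP; apply/eqP/h.
Qed.

(** The factorial counts the cyclic orders on [P], and for [eps] equal to -1 the power is the sign
    of a cycle on [P]. The value 0 lets sums run over all partitions while only those with constant
    blocks contribute. *)
Definition cycle_weight eps P : K :=
  if constant_on P then eps ^+ #|P|.-1 * (#|P|.-1)`!%:R else 0.

Definition level A x := [set y in A | m y == m x].

(** A new point can be inserted at [#|P|] places of a cycle on [P], each time adding one factor
    [eps]. The multiplier serves as [psi] in [partition_sum_pointed]. *)
Lemma cycle_weight_setU1 eps x P : x \notin P -> P != set0 ->
  cycle_weight eps (x |: P) =
  (if [forall y in P, m y == m x] then eps *+ #|P| else 0) * cycle_weight eps P.
Proof.
move=> xP P0; have /set0Pn[z zP] := P0.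
have cP : constant_on (x |: P) = [forall y in P, m y == m x] && constant_on P.
  apply/constant_onP/andP => [h|[/forall_inP h /constant_onP c]].
    split; last by apply/constant_onP=> i j iP jP; apply: h; rewrite setU1r.
    by apply/forall_inP => y yP; apply/eqP/h; rewrite ?setU11 ?setU1r.
  have c' i : i \in x |: P -> m i = m x.
    by rewrite in_setU1 => /orP[/eqP->//|/h/eqP].
  by move=> i j /c' -> /c' ->.
rewrite /cycle_weight cP.
case: [forall y in P, m y == m x]; last by rewrite mul0r.
case: constant_on => /=; last by rewrite mulr0.
have: (0 < #|P|)%N by rewrite card_gt0.
rewrite cardsU1 xP add1n; case: #|P| => // p _ /=.
by rewrite factS natrM exprS -mulr_natr; ring.
Qed.

(** The empty [B] makes [x] a singleton and gives the term 1. The other [B] give a sum over marked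
    blocks, in which the blocks where [m] takes the value [m x] have total size [#|level A x|]. *)
Lemma partition_sum_cycle_weight eps x A : x \notin A ->
  partition_sum (cycle_weight eps) (x |: A) =
  partition_sum (cycle_weight eps) A * (1 + eps *+ #|level A x|).
Proof.
move=> xA; rewrite partition_sum_setU1 // (bigD1 set0) ?sub0set //=.
have -> : cycle_weight eps (x |: set0) = 1.
  rewrite setU0 /cycle_weight cards1 mulr1 ifT //.
  by apply/constant_onP=> i j /set1P -> /set1P ->.
rewrite setD0 mul1r mulrDr mulr1; congr (_ + _).
under eq_bigr => B /andP[BA B0] do
  rewrite (cycle_weight_setU1 _ (contra (subsetP BA x) xA) B0).
rewrite partition_sum_pointed [RHS]mulrC /partition_sum big_distrr /=.
apply: eq_bigr => Pi PiP.
(* With a nonconstant block both products vanish, so the multipliers need comparing only when all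
   blocks are constant. *)
have [/forall_inP c|] := boolP [forall P in Pi, constant_on P]; last first.
  rewrite negb_forall_in => /exists_inP[P PPi /negbTE cP].
  have -> : \prod_(Q in Pi) cycle_weight eps Q = 0.
    by rewrite (bigD1 P) //= /cycle_weight cP mul0r.
  by rewrite !mulr0.
congr (_ * _).
transitivity (eps *+ \sum_(P in Pi) if [forall y in P, m y == m x] then #|P| else 0%N).
  by rewrite -sumrMnr; apply: eq_bigr => P _; case: ifP.
congr (_ *+ _); rewrite -sum1_card /level
  (eq_bigl (fun y => (y \in A) && (m y == m x))); last first.
  by move=> y; rewrite inE.
rewrite (set_partition_big_cond Pi PiP); apply: eq_bigr => P PPi.
have /constant_onP cP := c P PPi.
case: ifP => [/forall_inP h|].
  rewrite -sum1_card; apply: eq_bigl => y.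
  by case: (boolP (y \in P)) => //= /h ->.
move/negbT; rewrite negb_forall_in => /exists_inP[z zP /negbTE mz].
by rewrite big_pred0 // => y; apply/negP=> /andP[/cP/(_ zP) ->]; rewrite mz.
Qed.

(** The stabiliser of [m] among the permutations supported in [A]. *)
Definition level_perms A :=
  [set s : {perm T} | perm_on A s && [forall i, m (s i) == m i]].

Lemma level_permsP A s :
  reflect (perm_on A s /\ forall i, m (s i) = m i) (s \in level_perms A).
Proof.
rewrite inE; apply: (iffP andP) => -[h c]; split=> //.
  by move=> i; apply/eqP/(forallP c).
by apply/forallP => i; apply/eqP.
Qed.

(** Orbit counting: the images of [x] form [x |: level A x], and the permutations with a prescribed
    image of [x] form a coset of [level_perms A]. *)
Lemma card_level_perms_setU1 x A : x \notin A ->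
  #|level_perms (x |: A)| = (#|level_perms A| * (#|level A x|).+1)%N.
Proof.
move=> xA.
have xl : x \notin level A x by rewrite inE (negbTE xA).
(* The successor becomes the cardinal of [x |: level A x], over which the images of [x] are then
   sorted. *)
rewrite -[(#|level A x|).+1]/(true + #|level A x|)%N -{1}xl -cardsU1.
rewrite -sum1_card (partition_big (fun s : {perm T} => s x)
  [in x |: level A x]) /=; last first.
  move=> s /level_permsP[sA sm]; rewrite !inE sm eqxx andbT.
  by have := perm_closed x sA; rewrite setU11 !inE.
rewrite mulnC -sum_nat_const; apply: eq_bigr => y yl.
have mxy : m y = m x.
  by move: yl; rewrite !inE => /orP[/eqP->//|/andP[_ /eqP]].
have yA : y \in x |: A.
  by move: yl; rewrite !inE => /orP[->//|/andP[->]]; rewrite orbT.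
have mt i : m (tperm x y i) = m i by case: tpermP => [->|->|].
have pt : perm_on (x |: A) (tperm x y).
  by apply: subset_trans (tperm_on x y) _; rewrite subUset !sub1set setU11.
(* Products apply the left factor first, so [s * tperm x y] sends [x] to [y] exactly when [s] fixes
   [x]. *)
rewrite -[RHS]sum1_card (reindex_inj (mulIg (tperm x y))) /=.
apply: eq_bigl => s; rewrite permM.
apply/andP/level_permsP => [[/level_permsP[sA sm] /eqP sx]|[sA sm]].
  have sm' i : m (s i) = m i by rewrite -(sm i) permM mt.
  have fx : s x = x by apply: (@perm_inj _ (tperm x y)); rewrite sx tpermL.
  split=> //; apply/subsetP => i /= si.
  have : i \in x |: A.
    apply: (subsetP (_ : perm_on (x |: A) s)) si.
    by rewrite -(mulgK (tperm x y) s) tpermV perm_onM.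
  by rewrite in_setU1 => /orP[/eqP ix|//]; move: si; rewrite ix !inE fx eqxx.
have fx : s x = x by rewrite (out_perm sA).
split; last by rewrite fx tpermL.
apply/level_permsP; split=> [|i]; last by rewrite permM mt.
apply: perm_onM => //; apply: subset_trans sA _; exact: subsetUr.
Qed.

Lemma set_card_ind (Q : {set T} -> Prop) :
  Q set0 -> (forall x A, x \notin A -> Q A -> Q (x |: A)) -> forall A, Q A.
Proof.
move=> Q0 QU A; elim: {A}#|A| {-2}A (erefl #|A|) => [A /eqP|p IH A cA].
  by rewrite cards_eq0 => /eqP ->.
have /set0Pn[x xA] : A != set0 by rewrite -card_gt0 cA.
rewrite -(setD1K xA); apply: QU; first by rewrite setD11.
by apply: IH; move: cA; rewrite (cardsD1 x) xA => -[].
Qed.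

Lemma partition_sum_level_perms A :
  partition_sum (cycle_weight 1) A = #|level_perms A|%:R.
Proof.
elim/set_card_ind: A => [|x A xA IH].
  rewrite partition_sum0 (_ : level_perms set0 = [set 1%g]) ?cards1 //.
  apply/setP => s; rewrite in_set1; apply/level_permsP/eqP => [[s0 _]|->].
    by apply/permP => i; rewrite perm1 (out_perm s0) ?inE.
  by split=> [|i]; rewrite ?perm_on1 ?perm1.
by rewrite partition_sum_cycle_weight // IH card_level_perms_setU1 // natrM -natr1 addrC.
Qed.

(** Each new point contributes the factor 1 - l. While [m] is injective on [A], l is 0 or 1, and l =
    1 is the first collision; the value then stays 0. *)
Lemma partition_sum_inj A :
  partition_sum (cycle_weight (-1)) A = (dinjectiveb m A)%:R.
Proof.
elim/set_card_ind: A => [|x A xA IH].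
  by rewrite partition_sum0; case: dinjectiveP => // -[] i j; rewrite inE.
rewrite partition_sum_cycle_weight // IH.
have [iA|niA] := dinjectiveP.
  have [l0|[y]] := set_0Vmem (level A x).
    rewrite l0 cards0 mulr0n addr0 mulr1.
    have lx y : y \in A -> m y = m x -> False.
      move=> yA mxy; suff : y \in level A x by rewrite l0 inE.
      by rewrite inE yA mxy eqxx.
    case: dinjectiveP => // -[] i j; rewrite !inE.
    by move=> /orP[/eqP->|iA'] /orP[/eqP->|jA'] // e;
      [case: (lx j) | case: (lx i) | apply: iA].
  rewrite inE => /andP[yA /eqP mxy].
  have -> : level A x = [set y].
    apply/setP => z; rewrite !inE; apply/andP/eqP => [[zA /eqP mz]|->].
      by apply: iA => //; rewrite mz.
    by rewrite yA mxy eqxx.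
  rewrite cards1 mulr1n subrr mulr0; case: dinjectiveP => // h.
  by move: xA; rewrite -(h y x) ?yA // ?setU11 ?setU1r.
rewrite mul0r; case: dinjectiveP => // h; case: niA => i j iA jA.
by apply: h; rewrite setU1r.
Qed.

End LevelSets.

(** * Permutations arranging the values of [m] in decreasing order *)

Section SortingPermutations.
Variables (n : nat) (m : 'I_n -> nat).

Definition sorting_perms : {set 'S_n} :=
  [set s : 'S_n | [forall i : 'I_n, forall j : 'I_n, (i <= j)%N ==> (m (s j) <= m (s i))%N]].

Definition strict_sorting_perms : {set 'S_n} :=
  [set s : 'S_n | [forall i : 'I_n, forall j : 'I_n, (i < j)%N ==> (m (s j) < m (s i))%N]].

Lemma sorting_permsE s :
  (s \in sorting_perms) = sorted geq [tuple m (s i) | i < n].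
Proof.
rewrite inE.
have nthE (i : 'I_n) : nth 0%N [tuple m (s i) | i < n] i = m (s i).
  by rewrite -tnth_nth tnth_mktuple.
have gt : transitive geq by move=> ? ? ? /= h1 h2; apply: leq_trans h2 h1.
have gr : reflexive geq by move=> ? /=.
apply/forallP/idP => [h|h i].
  apply/(sortedP 0%N) => i; rewrite size_tuple => i1.
  have := forallP (h (Ordinal (ltnW i1))) (Ordinal i1).
  by rewrite /= leqnSn /= -!nthE.
apply/forallP => j; apply/implyP => ij.
by rewrite -!nthE; apply: (sorted_leq_nth gt gr 0%N h); rewrite ?inE ?size_tuple.
Qed.

Lemma sorting_perms_ex : exists s, s \in sorting_perms.
Proof.
have /tuple_permP[s e] : perm_eq (sort geq [tuple m i | i < n]) [tuple m i | i < n].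
  by rewrite perm_sort.
exists s; rewrite sorting_permsE.
have -> : val [tuple m (s i) | i < n] = sort geq [tuple m i | i < n].
  by rewrite e; congr val; apply: eq_from_tnth => i; rewrite !tnth_mktuple.
by apply: sort_sorted => x y /=; apply: leq_total.
Qed.

(** The decreasing rearrangement is unique as a sequence, so [s] sorts [m] if and only if [m]
    composed with [s] agrees with [m] composed with one fixed sorting permutation [s0]. *)
Lemma card_sorting_perms : #|sorting_perms| = #|level_perms m [set: 'I_n]|.
Proof.
have [s0 s0P] := sorting_perms_ex.
have E s : (s \in sorting_perms) = [forall i, m (s i) == m (s0 i)].
  apply/idP/forallP => [sP i|h]; last first.
    move: s0P; rewrite !sorting_permsE; congr (sorted geq (val _)).
    by apply: eq_from_tnth => i; rewrite !tnth_mktuple; apply/esym/eqP/h.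
  have perm_m (u : 'S_n) : perm_eq [tuple m (u i) | i < n] [tuple m i | i < n].
    apply/tuple_permP; exists u; congr val.
    by apply: eq_from_tnth => j; rewrite !tnth_mktuple.
  have : val [tuple m (s i) | i < n] = val [tuple m (s0 i) | i < n].
    apply: (@sorted_eq _ geq).
    - by move=> ? ? ? /= h1 h2; apply: leq_trans h2 h1.
    - by move=> x y h; apply/eqP; rewrite eqn_leq andbC; exact: h.
    - by rewrite -sorting_permsE.
    - by rewrite -sorting_permsE.
    - by apply: perm_trans (perm_m s) _; rewrite perm_sym; apply: perm_m.
  by move/val_inj/(congr1 (fun t => tnth t i)); rewrite !tnth_mktuple => ->.
(* Left multiplication by [s0^-1] carries the sorting permutations onto the stabiliser of [m]. *)
rewrite -(card_imset _ (mulgI (s0^-1)%g)); apply: eq_card => s.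
apply/imsetP/level_permsP => [[u]|[_ h]].
  rewrite E => /forallP h ->; split=> [|i]; first by apply/subsetP => i; rewrite inE.
  by rewrite permM (eqP (h _)) permKV.
exists (s0 * s)%g; last by rewrite mulKg.
by rewrite E; apply/forallP => i; rewrite permM h.
Qed.

(** For injective [m] strict and weak sorting coincide and the stabiliser is trivial; a repeated
    value rules out strict sorting. *)
Lemma card_strict_sorting_perms : #|strict_sorting_perms| = injectiveb m.
Proof.
have [im|nim] := injectiveP m.
  have -> : strict_sorting_perms = sorting_perms.
    apply/setP => s; rewrite !inE; apply: eq_forallb => i; apply: eq_forallb => j.
    rewrite [(m (s j) < _)%N]ltn_neqAle [(i < j)%N]ltn_neqAle.
    rewrite (inj_eq im) (inj_eq perm_inj) -(inj_eq val_inj) [val j == _]eq_sym /=.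
    by case: (val i =P val j) => [/val_inj ->|//]; rewrite !leqnn.
  rewrite card_sorting_perms; apply/eqP/cards1P; exists 1%g.
  apply/setP => s; rewrite in_set1; apply/level_permsP/eqP => [[_ h]|->].
    by apply/permP => i; rewrite perm1; apply: im.
  by split=> [|i]; rewrite ?perm_on1 ?perm1.
apply/eqP; rewrite cards_eq0; apply/eqP/setP => s; rewrite !inE.
apply/negP => /forallP h; case: nim => i j; rewrite -(permKV s i) -(permKV s j).
move: (_ i) (_ j) => {}i {}j mij; congr (s _); apply/val_inj.
have lt (u v : 'I_n) : m (s u) = m (s v) -> (u < v)%N -> False.
  by move=> e uv; have /forallP/(_ v) := h u; rewrite uv e ltnn.
by case: (ltngtP i j) => // /lt [].
Qed.

End SortingPermutations.

(** * Expansion of both sides over a finite set of functions *)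

Section FiniteIdentity.
Variables (T V : finType) (K : comNzRingType) (g : V -> T -> K).

(** Expanding the product chooses one value per block, which amounts to a function constant on the
    blocks. *)
Lemma sum_constant_on_partition (v0 : V) (Pi : {set {set T}}) : partition Pi [set: T] ->
  \prod_(P in Pi) \sum_v \prod_(i in P) g v i =
  \sum_(m : {ffun T -> V} | [forall P in Pi, constant_on m P]) \prod_i g (m i) i.
Proof.
move=> PiP; have triv := partition_trivIset PiP.
have pbl i : pblock Pi i \in Pi by rewrite pblock_mem // (cover_partition PiP) inE.
have inpbl i : i \in pblock Pi i by rewrite mem_pblock (cover_partition PiP) inE.
(* Choices of values are functions on all sets that equal [v0] off [Pi]; [down] and [up] translate
   between them and functions on points. *)
pose val_on (m : {ffun T -> V}) (P : {set T}) := if [pick i in P] is Some i then m i else v0.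
pose down (f : {ffun {set T} -> V}) : {ffun T -> V} := [ffun i => f (pblock Pi i)].
pose up (m : {ffun T -> V}) : {ffun {set T} -> V} :=
  [ffun P => if P \in Pi then val_on m P else v0].
rewrite (big_distr_big v0) /= (reindex_onto down up) /=; last first.
  move=> m /forall_inP c; apply/ffunP => i; rewrite !ffunE pbl /val_on.
  case: pickP => [j ji|/(_ i)]; last by rewrite inpbl.
  by have /constant_onP := c _ (pbl i); apply.
apply: eq_big => [f|f fP].
  apply/pffun_onP/andP => [[sf _]|[_ /eqP <-]].
    split.
      apply/forall_inP => P PPi; apply/constant_onP => i j iP jP.
      by rewrite !ffunE !(def_pblock triv PPi).
    apply/eqP/ffunP => P; rewrite ffunE; case: ifPn => PPi; last first.
      apply/eqP; rewrite eq_sym; apply: contraNT PPi => fP0.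
      by apply: (subsetP sf); rewrite inE.
    rewrite /val_on; case: pickP => [i iP|P0].
      by rewrite ffunE (def_pblock triv PPi).
    have /set0Pn[i iP] := partition_neq0 PiP PPi; by have := P0 i; rewrite iP.
  split=> //; apply/subsetP => P; rewrite inE ffunE.
  by case: ifP => // _; rewrite eqxx.
have -> : \prod_i g (down f i) i = \prod_(i in [set: T]) g (down f i) i.
  by apply: eq_bigl => i; rewrite inE.
rewrite (set_partition_big Pi PiP); apply: eq_bigr => P PPi.
by apply: eq_bigr => i iP; rewrite ffunE (def_pblock triv PPi).
Qed.

Lemma partition_sum_prod (v0 : V) (eps : K) :
  partition_sum (fun P => eps ^+ #|P|.-1 * (#|P|.-1)`!%:R *
    \sum_v \prod_(i in P) g v i) [set: T] =
  \sum_(m : {ffun T -> V})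
    partition_sum (cycle_weight m eps) [set: T] * \prod_i g (m i) i.
Proof.
rewrite /partition_sum; under [RHS]eq_bigr do rewrite big_distrl /=.
rewrite exchange_big /=; apply: eq_bigr => Pi PiP.
rewrite big_split /= (sum_constant_on_partition v0 PiP) big_distrr /=.
rewrite big_mkcond /=; apply: eq_bigr => m _.
case: ifPn => [/forall_inP c|].
  by congr (_ * _); apply: eq_bigr => P /c cP; rewrite /cycle_weight cP.
rewrite negb_forall_in => /exists_inP[P PPi /negbTE cP].
by rewrite (bigD1 P) //= /cycle_weight cP !mul0r.
Qed.

(** Composing [m] with [s] moves the permutation from the summand into the condition [D], so that it
    is merely counted. *)
Lemma sum_perm_reindex (D : pred {ffun T -> V}) :
  \sum_(s : {perm T}) \sum_(m : {ffun T -> V} | D m) \prod_i g (m i) (s i) =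
  \sum_(m : {ffun T -> V})
    #|[set s : {perm T} | D [ffun i => m (s i)]]|%:R * \prod_i g (m i) i.
Proof.
pose act (s : {perm T}) (m : {ffun T -> V}) : {ffun T -> V} := [ffun i => m (s i)].
have actK s : cancel (act s) (act s^-1%g).
  by move=> m; apply/ffunP => i; rewrite !ffunE permKV.
transitivity (\sum_(s : {perm T}) \sum_(m | D (act s m)) \prod_i g (m i) i).
  apply: eq_bigr => s _; rewrite (reindex_inj (can_inj (actK s))) /=.
  apply: eq_bigr => m _; rewrite [RHS](reindex_inj (@perm_inj _ s)) /=.
  by apply: eq_bigr => i _; rewrite ffunE.
rewrite (exchange_big_dep xpredT) //=; apply: eq_bigr => m _.
by rewrite sumr_const -[LHS]mulr_natl; congr (_%:R * _); apply: eq_card => s; rewrite inE.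
Qed.

End FiniteIdentity.

(* Imported only here: its [set0], [setT], ... shadow those of finset. *)
From mathcomp Require Import finmap.
From mathcomp Require Import all_classical all_reals all_analysis.
Import numFieldNormedType.Exports.

(** * Unordered sums of nonnegative terms as limits of sums over boxes *)

Section BoxSums.
Local Open Scope classical_set_scope.
Variables (R : realType) (n : nat).
Implicit Types (A : classical_sets.set {ffun 'I_n -> nat}) (f : {ffun 'I_n -> nat} -> R).

Definition box_emb M (m : {ffun 'I_n -> 'I_M}) : {ffun 'I_n -> nat} := [ffun i => m i : nat].

Lemma box_emb_inj M : injective (@box_emb M).
Proof.
move=> m1 m2 /ffunP e; apply/ffunP => i; apply: val_inj.
by have := e i; rewrite !ffunE.
Qed.

Definition box_sum A f M : R :=
  \sum_(m : {ffun 'I_n -> 'I_M.+1} | `[< A (box_emb m) >]) f (box_emb m).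

Lemma cvg_box_sum A f : (forall m, 0 <= f m) ->
  (\esum_(m in A) (f m)%:E)%E \is a fin_num ->
  box_sum A f M @[M --> \oo] --> fine (\esum_(m in A) (f m)%:E)%E.
Proof.
move=> f0 finf; set l := fine _.
have lE : (\esum_(m in A) (f m)%:E)%E = l%:E by rewrite fineK.
have box_le M : box_sum A f M <= l.
  rewrite -lee_fin -lE; apply: ereal_sup_ubound.
  (* The box sum is itself one of the finite sums whose supremum is [l]. *)
  pose s := [seq box_emb m | m <- enum {ffun 'I_n -> 'I_M.+1} & `[< A (box_emb m) >]].
  exists [set` s].
    split; first exact: finite_seq.
    by move=> _ /mapP[m + ->]; rewrite mem_filter => /andP[/asboolP].
  rewrite -fsbig_seq; last first.
    by rewrite map_inj_uniq; [exact/filter_uniq/enum_uniq | exact: box_emb_inj].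
  rewrite sumEFin; congr EFin; rewrite /s big_map big_filter /box_sum.
  by rewrite big_enum_cond.
apply/cvgrPdist_le => e e0.
have : ((l - e)%:E < ereal_sup [set \sum_(m \in F) (f m)%:E | F in fsets A])%E.
  by rewrite -/(esum _ _) lE lte_fin ltrBlDr ltrDl.
move=> /ereal_sup_gt[_ [F [finF FA] <-]].
rewrite fsumEFin // lte_fin fsbig_finite //= => leF.
(* The largest coordinate occurring in [F]: every box of bound at least [M0] contains [F], so its
   sum is within [e] of [l]. *)
pose M0 := (\max_(m <- fset_set F) \max_(i < n) m i)%N.
have leM m i : m \in fset_set F -> (m i <= M0)%N.
  move=> ms; apply: (@leq_trans (\max_(i < n) m i)).
    exact: (@leq_bigmax _ (fun i => m i)).
  by apply: (@leq_bigmax_seq _ (enum_fset (fset_set F)) xpredT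
    (fun m : {ffun _ -> _} => \max_(i < n) m i)%N m).
near=> M.
have M0M : (M0 <= M)%N by near: M; exact: nbhs_infty_ge.
rewrite ger0_norm ?subr_ge0 // lerBlDl -lerBlDr.
apply: le_trans (ltW leF) _.
pose h (m : {ffun 'I_n -> nat}) : {ffun 'I_n -> 'I_M.+1} := [ffun i => inord (m i)].
have hK m : m \in fset_set F -> box_emb (h m) = m.
  move=> ms; apply/ffunP => i; rewrite !ffunE inordK // ltnS.
  exact: leq_trans (leM _ _ ms) _.
rewrite big_seq (eq_bigr (fun m => f (box_emb (h m)))); last by move=> m /hK ->.
rewrite -big_seq -(big_map h xpredT (fun m => f (box_emb m))).
have us : uniq (map h (fset_set F)).
  by rewrite map_inj_in_uniq ?fset_uniq // => m1 m2 /hK {2}<- /hK {2}<- ->.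
rewrite big_uniq //= /box_sum [leRHS](bigID (mem (map h (fset_set F)))) /=.
rewrite -[leLHS]addr0 lerD ?sumr_ge0 // le_eqVlt; apply/orP; left; apply/eqP.
apply: eq_bigl => m; rewrite andbC; case: (boolP (m \in _)) => //= /mapP[m' m's ->].
rewrite hK //; apply/esym/asboolP/FA.
by move: m's; rewrite in_fset_set // inE.
Unshelve. all: by end_near. Qed.

End BoxSums.

(** * The two identities for truncated series *)

Section TruncatedSums.
Variables (R : realType) (N a : nat).
Local Open Scope classical_set_scope.

(** Positivity and the congruence are absorbed into the weight, so that only order conditions remain
    on the indices. *)
Definition progression_weight (v e : nat) : R :=
  if (0 < v)%N && (v == a %[mod N])%N then (v%:R ^+ e)^-1 else 0.

Lemma box_sum_term n (D : pred {ffun 'I_n -> nat}) (k : 'I_n -> nat) M :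
  box_sum [set m | D m /\ forall i, (0 < m i)%N /\ (m i = a %[mod N])%N] (t_term R k) M =
  \sum_(m : {ffun 'I_n -> 'I_M.+1} | D (box_emb m))
    \prod_i progression_weight (m i) (k i).
Proof.
rewrite /box_sum [RHS]big_mkcond [LHS]big_mkcond; apply: eq_bigr => m _.
case: asboolP => [[-> mP]|nP].
  rewrite /t_term div1r -prodfV; apply: eq_bigr => i _.
  rewrite /progression_weight ffunE.
  by have := mP i; rewrite ffunE => -[-> ->]; rewrite eqxx.
case: ifP => // Dm.
have [/forallP mP|] := boolP [forall i, (0 < m i)%N && (m i == a %[mod N])%N].
  case: nP; split=> // i; rewrite ffunE.
  by have /andP[? /eqP] := mP i.
rewrite negb_forall => /existsP[i /negbTE mi].
by rewrite (bigD1 i) //= /progression_weight mi mul0r.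
Qed.

(** Nonemptiness matters when [v] is excluded: the left side is then 0, while an empty product would
    be 1. *)
Lemma progression_weight_sum (I : finType) (P : {set I}) (k : I -> nat) v :
  P != finset.set0 ->
  progression_weight v (\sum_(i in P) k i) = \prod_(i in P) progression_weight v (k i).
Proof.
case/set0Pn => i iP; rewrite /progression_weight; case: ifP => _.
  by rewrite -prodrXr prodfV.
by rewrite (bigD1 i) //= mul0r.
Qed.

Lemma t_trunc n (k : 'I_n -> nat) M : box_sum (t_index N a n) (t_term R k) M =
  \sum_(m : {ffun 'I_n -> 'I_M.+1} |
      [forall i : 'I_n, forall j : 'I_n, (i < j)%N ==> (m j < m i)%N])
    \prod_i progression_weight (m i) (k i).
Proof.
pose D (m : {ffun 'I_n -> nat}) :=
  [forall i : 'I_n, forall j : 'I_n, (i < j)%N ==> (m j < m i)%N].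
have -> : t_index N a n =
    [set m | D m /\ forall i, (0 < m i)%N /\ (m i = a %[mod N])%N].
  rewrite /t_index; apply/seteqP; split=> m [h mP]; split=> //.
    by apply/forallP => i; apply/forallP => j; apply/implyP/h.
  by move=> i j; apply/implyP/(forallP (forallP h i)).
rewrite box_sum_term; apply: eq_bigl => m.
by apply: eq_forallb => i; apply: eq_forallb => j; rewrite !ffunE.
Qed.

Lemma tstar_trunc n (k : 'I_n -> nat) M : box_sum (tstar_index N a n) (t_term R k) M =
  \sum_(m : {ffun 'I_n -> 'I_M.+1} |
      [forall i : 'I_n, forall j : 'I_n, (i <= j)%N ==> (m j <= m i)%N])
    \prod_i progression_weight (m i) (k i).
Proof.
pose D (m : {ffun 'I_n -> nat}) :=
  [forall i : 'I_n, forall j : 'I_n, (i <= j)%N ==> (m j <= m i)%N].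
have -> : tstar_index N a n =
    [set m | D m /\ forall i, (0 < m i)%N /\ (m i = a %[mod N])%N].
  rewrite /tstar_index; apply/seteqP; split=> m [h mP]; split=> //.
    by apply/forallP => i; apply/forallP => j; apply/implyP/h.
  by move=> i j; apply/implyP/(forallP (forallP h i)).
rewrite box_sum_term; apply: eq_bigl => m.
by apply: eq_forallb => i; apply: eq_forallb => j; rewrite !ffunE.
Qed.

Lemma sum_ffun_ord1 (V : finType) (F : V -> R) :
  \sum_(m : {ffun 'I_1 -> V}) \prod_(i < 1) F (m i) = \sum_v F v.
Proof. by rewrite -(bigA_distr_bigA (fun=> F)) big_ord1. Qed.

(** A single variable carries no order condition, and the weight is multiplicative in the
    exponents. *)
Lemma t_trunc1 (I : finType) (P : {set I}) (k : I -> nat) M : P != finset.set0 ->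
  box_sum (t_index N a 1) (t_term R (fun=> \sum_(i in P) k i)%N) M =
  \sum_(v : 'I_M.+1) \prod_(i in P) progression_weight v (k i).
Proof.
move=> P0; rewrite t_trunc -sum_ffun_ord1; apply: eq_big => [m|m _].
  by apply/forallP => i; apply/forallP => j; rewrite !ord1.
by apply: eq_bigr => i _; apply: progression_weight_sum.
Qed.

Lemma tstar_trunc1 (I : finType) (P : {set I}) (k : I -> nat) M : P != finset.set0 ->
  box_sum (tstar_index N a 1) (t_term R (fun=> \sum_(i in P) k i)%N) M =
  \sum_(v : 'I_M.+1) \prod_(i in P) progression_weight v (k i).
Proof.
move=> P0; rewrite tstar_trunc -sum_ffun_ord1; apply: eq_big => [m|m _].
  by apply/forallP => i; apply/forallP => j; rewrite !ord1 !leqnn.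
by apply: eq_bigr => i _; apply: progression_weight_sum.
Qed.

Lemma cvg_t_trunc n (k : 'I_n -> nat) : (forall i, (1 < k i)%N) ->
  box_sum (t_index N a n) (t_term R k) M @[M --> \oo] --> t_sum R N a k.
Proof.
by move=> k1; apply: cvg_box_sum; [exact: t_term_ge0 | exact: t_fin_num].
Qed.

Lemma cvg_tstar_trunc n (k : 'I_n -> nat) : (forall i, (1 < k i)%N) ->
  box_sum (tstar_index N a n) (t_term R k) M @[M --> \oo] --> tstar_sum R N a k.
Proof.
by move=> k1; apply: cvg_box_sum; [exact: t_term_ge0 | exact: tstar_fin_num].
Qed.

Lemma cvg_sumr (I : Type) (r : seq I) (P : pred I) (u : I -> nat -> R) (l : I -> R) :
  (forall i, P i -> u i M @[M --> \oo] --> l i) ->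
  \sum_(i <- r | P i) u i M @[M --> \oo] --> \sum_(i <- r | P i) l i.
Proof. by move=> h; apply: cvg_big => //; exact: add_continuous. Qed.

Lemma cvg_prodr (I : Type) (r : seq I) (P : pred I) (u : I -> nat -> R) (l : I -> R) :
  (forall i, P i -> u i M @[M --> \oo] --> l i) ->
  \prod_(i <- r | P i) u i M @[M --> \oo] --> \prod_(i <- r | P i) l i.
Proof. by move=> h; apply: cvg_big => //; exact: mul_continuous. Qed.

Variables (n : nat) (k : 'I_n -> nat).

Lemma t_trunc_identity M :
  \sum_(s : 'S_n) box_sum (t_index N a n) (t_term R (fun i => k (s i))) M =
  \sum_(Pi in set_partitions n) (cpart_tilde Pi)%:~R *
     \prod_(P in Pi) box_sum (t_index N a 1) (t_term R (fun=> \sum_(i in P) k i)%N) M.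
Proof.
under eq_bigr do rewrite t_trunc.
have := sum_perm_reindex (fun (v : 'I_M.+1) i => progression_weight v (k i))
  (fun m : {ffun 'I_n -> 'I_M.+1} =>
    [forall i : 'I_n, forall j : 'I_n, (i < j)%N ==> (m j < m i)%N]).
move=> /= ->.
(* Both coefficients of [m] are 1 or 0 according to whether [m] is injective. *)
transitivity (\sum_(m : {ffun 'I_n -> 'I_M.+1})
    partition_sum (cycle_weight m (-1 : R)) [set: 'I_n]%SET *
    \prod_i progression_weight (m i) (k i)).
  apply: eq_bigr => m _; congr (_ * _); rewrite partition_sum_inj.
  have := card_strict_sorting_perms (fun i => m i : nat).
  rewrite /strict_sorting_perms.
  have -> : injectiveb (fun i => m i : nat) = dinjectiveb m [set: 'I_n]%SET.
    apply/injectiveP/dinjectiveP => [h i j _ _ e|h i j e].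
      by apply: h; rewrite e.
    by apply: h; rewrite ?inE //; apply: val_inj.
  move=> <-; congr (_%:R); apply: eq_card => s; rewrite !inE.
  by apply: eq_forallb => i; apply: eq_forallb => j; rewrite !ffunE.
rewrite -(partition_sum_prod (fun (v : 'I_M.+1) i => progression_weight v (k i)) ord0).
rewrite /partition_sum.
apply: eq_big => [Pi|Pi PiP]; first by rewrite inE.
rewrite big_split /=; congr (_ * _); last first.
  by apply: eq_bigr => P PPi; rewrite t_trunc1 // (partition_neq0 PiP).
rewrite big_split /= /cpart_tilde intrM rmorphXn /= rmorphN1; congr (_ * _).
  rewrite prodrXr; congr (_ ^+ _).
  (* The global sign exponent [n - #|Pi|] is the sum of the block exponents [#|P| - 1]; no
     truncation occurs since blocks are nonempty. *)
  have cardn : n = (\sum_(P in Pi) #|P|)%N.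
    by rewrite -(card_partition PiP) cardsT card_ord.
  rewrite [X in (X - _)%N]cardn -sum1_card.
  rewrite -sumnB; last by move=> P PPi; rewrite card_gt0 (partition_neq0 PiP).
  by apply: eq_bigr => P _; rewrite subn1.
by rewrite /cpart -pmulrn natr_prod.
Qed.

Lemma tstar_trunc_identity M :
  \sum_(s : 'S_n) box_sum (tstar_index N a n) (t_term R (fun i => k (s i))) M =
  \sum_(Pi in set_partitions n) (cpart Pi)%:R *
     \prod_(P in Pi) box_sum (tstar_index N a 1) (t_term R (fun=> \sum_(i in P) k i)%N) M.
Proof.
under eq_bigr do rewrite tstar_trunc.
have := sum_perm_reindex (fun (v : 'I_M.+1) i => progression_weight v (k i))
  (fun m : {ffun 'I_n -> 'I_M.+1} =>
    [forall i : 'I_n, forall j : 'I_n, (i <= j)%N ==> (m j <= m i)%N]).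
move=> /= ->.
(* Both coefficients of [m] are the order of its stabiliser. *)
transitivity (\sum_(m : {ffun 'I_n -> 'I_M.+1})
    partition_sum (cycle_weight m (1 : R)) [set: 'I_n]%SET *
    \prod_i progression_weight (m i) (k i)).
  apply: eq_bigr => m _; congr (_ * _); rewrite partition_sum_level_perms.
  have -> : level_perms m [set: 'I_n]%SET =
      level_perms (fun i => m i : nat) [set: 'I_n]%SET.
    by apply/setP => s; rewrite !inE; congr (_ && _); apply: eq_forallb.
  rewrite -card_sorting_perms; congr (_%:R); apply: eq_card => s; rewrite !inE.
  by apply: eq_forallb => i; apply: eq_forallb => j; rewrite !ffunE.
rewrite -(partition_sum_prod (fun (v : 'I_M.+1) i => progression_weight v (k i)) ord0).
rewrite /partition_sum.
apply: eq_big => [Pi|Pi PiP]; first by rewrite inE.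
rewrite big_split /=; congr (_ * _); last first.
  by apply: eq_bigr => P PPi; rewrite tstar_trunc1 // (partition_neq0 PiP).
rewrite /cpart natr_prod; apply: eq_bigr => P _.
by rewrite expr1n mul1r.
Qed.

(** Gives convergence of the one-variable series attached to each block. *)
Lemma lt1_sum_partition (Pi : {set {set 'I_n}}) P :
  (forall i, (1 < k i)%N) -> finset.partition Pi [set: 'I_n]%SET -> P \in Pi ->
  (1 < \sum_(i in P) k i)%N.
Proof.
move=> k1 PiP PPi; have /set0Pn[i iP] := partition_neq0 PiP PPi.
by rewrite (bigD1 i) //=; apply: leq_trans (k1 i) (leq_addr _ _).
Qed.

End TruncatedSums.

(** * Passage to the limit in the truncated identities *)

Theorem proposition3p1 (R : realType) (N a n : nat) (k : 'I_n -> nat)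
  (hN : (0 < N)%N) (ha : (1 <= a <= N)%N)
  (hn : (0 < n)%N) (hk : forall i : 'I_n, (1 < k i)%N) :
  (\sum_(s : 'S_n) t_sum R N a (fun i => k (s i)) =
   \sum_(Pi in set_partitions n) (cpart_tilde Pi)%:~R * t_part R N a k Pi) /\
  (\sum_(s : 'S_n) tstar_sum R N a (fun i => k (s i)) =
   \sum_(Pi in set_partitions n) (cpart Pi)%:R * tstar_part R N a k Pi).
Proof.
split.
  (* The truncated left side tends to the full left side; by the truncated identity the same
     sequence tends to the right side, and limits are unique. *)
  apply: (cvg_unique _ (cvg_sumr (fun (s : 'S_n) _ =>
    @cvg_t_trunc R N a n (fun i => k (s i)) (fun i => hk (s i))))).
    exact: norm_hausdorff.
  rewrite /=; under eq_cvg do rewrite t_trunc_identity.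
  apply: cvg_sumr => Pi; rewrite inE => PiP; apply: cvgMr.
  apply: cvg_prodr => P PPi; apply: cvg_t_trunc => _.
  exact: lt1_sum_partition hk PiP PPi.
apply: (cvg_unique _ (cvg_sumr (fun (s : 'S_n) _ =>
  @cvg_tstar_trunc R N a n (fun i => k (s i)) (fun i => hk (s i))))).
  exact: norm_hausdorff.
rewrite /=; under eq_cvg do rewrite tstar_trunc_identity.
apply: cvg_sumr => Pi; rewrite inE => PiP; apply: cvgMr.
apply: cvg_prodr => P PPi; apply: cvg_tstar_trunc => _.
exact: lt1_sum_partition hk PiP PPi.
Qed.
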